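(* Consider the sender-receiver game $\Gamma$ with data $(K,p,M,X,(U^k)_{k\in K},(V^k)_{k\in K},(u_0^k)_{k\in K})$ described in the context. If the participation structure $\mathcal{T}^*$ of $\Gamma$ is a partition of $K$, then $\Gamma$ has a partitional equilibrium.
   Context: Data of the game $\Gamma$. $K$ is a nonempty finite set of types; $p\in\Delta(K)$ is a prior probability with $p^k>0$ for every $k\in K$; $M$ is a finite set of messages with $|M|\ge|K|$; $X$ is a compact (topological) space of decisions; for every $k\in K$, $U^k:X\to\mathbb{R}$ (sender, player 1) and $V^k:X\to\mathbb{R}$ (receiver, player 2) are continuous utility functions and $u_0^k\in\mathbb{R}$ is the sender's outside option. It is assumed that for every $k\in K$ there exists $x\in X$ with $U^k(x)\ge u_0^k$. ($\Delta(S)$ denotes the set of probability distributions on a finite set $S$.) Interpretation: a type $k$ is drawn from $p$ and told to the sender, who sends a message $m\in M$; the receiver then proposes $x\in X$; if the sender accepts, payoffs are $U^k(x),V^k(x)$; if he rejects (exit), he gets $u_0^k$ and the receiver gets $-\infty$. The sender of type $k$ accepts $x$ if and only if $U^k(x)\ge u_0^k$. The receiver's equilibrium expected utility is required to be finite. For $L\subseteq K$ let $X(L)=\{x\in X: U^k(x)\ge u_0^k \ \forall k\in L\}$. Let $\mathcal{T}=\{L\subseteq K: L\neq\emptyset,\ X(L)\ne\emptyset\}$. The participation structure $\mathcal{T}^*$ of $\Gamma$ is the set of maximal elements of $\mathcal{T}$ for set inclusion. A strategy of the sender is a map $\sigma:K\to\Delta(M)$, written $\sigma(m\mid k)$; a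 strategy of the receiver is a map $\tau:M\to X$. Put $P_\sigma(m)=\sum_{k}p^k\sigma(m\mid k)$ and, if $P_\sigma(m)>0$, $p_m^k(\sigma)=p^k\sigma(m\mid k)/P_\sigma(m)$, $p_m(\sigma)=(p_m^k(\sigma))_{k\in K}\in\Delta(K)$, with support $\mathrm{supp}\,p_m(\sigma)\subseteq K$. An equilibrium of $\Gamma$ is a pair $(\sigma,\tau)$ such that (1) (incentive compatibility) $U^k(\tau(m))\ge U^k(\tau(m'))$ for all $k\in K$, all $m\in M$ with $\sigma(m\mid k)>0$ and all $m'\in M$; (2) (constrained optimization, no exit) for every $m\in M$ with $P_\sigma(m)>0$, $X(\mathrm{supp}\,p_m(\sigma))\ne\emptyset$ and $\tau(m)\in\arg\max_{x\in X(\mathrm{supp}\,p_m(\sigma))}\sum_{k}p_m^k(\sigma)V^k(x)$. An equilibrium is partitional if $\sigma$ is pure, i.e., for every $k\in K$, $\sigma(\cdot\mid k)$ is concentrated on a single message. *)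

(* Defs.v *)
From HB Require Import structures.
From mathcomp Require Import all_boot all_order all_algebra.
From mathcomp Require Import all_classical all_reals all_analysis.
Import Order.TTheory GRing.Theory Num.Theory.
Import numFieldNormedType.Exports.

Set Implicit Arguments.
Unset Strict Implicit.
Unset Printing Implicit Defensive.

Local Open Scope classical_set_scope.
Local Open Scope ring_scope.

Definition is_distr (R : realType) (S : finType) (f : S -> R) : Prop :=
  (forall s, 0 <= f s) /\ \sum_(s : S) f s = 1.

Definition supp (R : realType) (S : finType) (f : S -> R) : {set S} :=
  [set s | f s != 0]%SET.

Definition argmax (R : realType) (X : Type) (A : set X) (f : X -> R) : set X :=
  [set x | A x /\ forall y, A y -> f y <= f x].

Section Participation.
Variables (R : realType) (K : finType) (X : Type).
Variables (U : K -> X -> R) (u0 : K -> R).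

Definition acceptable (L : {set K}) : set X :=
  [set x | forall k, k \in L -> u0 k <= U k x].

Definition jointly_acceptable : {set {set K}} :=
  [set L : {set K} | (L != finset.set0) && `[< acceptable L !=set0 >]]%SET.

Definition participation_structure : {set {set K}} :=
  [set L : {set K} | maxset (fun A => A \in jointly_acceptable) L]%SET.

End Participation.

Section Beliefs.
Variables (R : realType) (K M : finType).
(* [sigma k m] is the probability that type [k] sends message [m]. *)
Variables (p : K -> R) (sigma : K -> M -> R).

Definition message_prob (m : M) : R := \sum_(k : K) p k * sigma k m.

(* Only meaningful when [0 < message_prob m]. *)
Definition posterior (m : M) (k : K) : R := p k * sigma k m / message_prob m.

End Beliefs.

Section Equilibrium.
Variables (R : realType) (K M : finType) (X : Type).
Variables (p : K -> R) (U V : K -> X -> R) (u0 : K -> R).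
Variables (sigma : K -> M -> R) (tau : M -> X).

Definition sender_strategy : Prop := forall k, is_distr (sigma k).

Definition incentive_compatible : Prop :=
  forall k m m', 0 < sigma k m -> U k (tau m') <= U k (tau m).

(* The receiver optimizes among the decisions accepted by every type in the
   support of her belief, so there is no exit on the equilibrium path and her
   expected utility is finite. *)
Definition constrained_optimal : Prop :=
  forall m, 0 < message_prob p sigma m ->
    let q := posterior p sigma m in
    acceptable U u0 (supp q) !=set0 /\
    argmax (acceptable U u0 (supp q)) (fun x => \sum_(k : K) q k * V k x)
      (tau m).

Definition equilibrium : Prop :=
  [/\ sender_strategy, incentive_compatible & constrained_optimal].

Definition pure_strategy : Prop :=
  forall k, exists m, forall m', sigma k m' = (m' == m)%:R.

Definition partitional_equilibrium : Prop := equilibrium /\ pure_strategy.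

End Equilibrium.

(* Main.v *)
Require Import Defs.
From HB Require Import structures.
From mathcomp Require Import all_boot all_order all_algebra.
From mathcomp Require Import all_classical all_reals all_analysis.
Import Order.TTheory GRing.Theory Num.Theory.
Import numFieldNormedType.Exports.

(** A cell of the participation structure is the full set of types that accept
    any decision acceptable to all of it: enlarging it by another type that
    accepts the same decision would contradict maximality
    ([accepting_types_maximal]).  Hence, when these cells partition the types,
    letting every type announce its own cell and the receiver best-respond
    under the participation constraint is already an equilibrium.  A type that
    announces another cell is offered a decision that it rejects, so it falls
    below its outside option, which announcing the truth guarantees; and within
    a cell all types send the same message, so there is nothing to gain either.

    The remaining ingredients are the existence of constrained best responses
    by compactness ([argmax_expected_utility]), enough messages to label the
    cells ([labelling_of_classes]), and the fact that the posterior after a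
    cell's label is supported by exactly that cell ([supp_posterior_pure]).
    Messages sent by nobody are answered as if they were one of the labels, so
    they offer no new deviation. *)

Set Implicit Arguments.
Unset Strict Implicit.
Unset Printing Implicit Defensive.

Local Open Scope classical_set_scope.
Local Open Scope ring_scope.

(** All the types that accept [x] form a jointly acceptable set containing [L],
    so maximality leaves no room between the two. *)
Lemma accepting_types_maximal (R : realType) (K : finType) (X : Type)
    (U : K -> X -> R) (u0 : K -> R) (L : {set K}) (x : X) :
  L \in participation_structure U u0 -> acceptable U u0 L x ->
  L = [set k | u0 k <= U k x]%SET.
Proof.
rewrite inE => /maxsetP[]; rewrite inE => /andP[L0 _] maxL Lx.
have sLA : L \subset [set k | u0 k <= U k x]%SET.
  by apply/fintype.subsetP => k kL; rewrite inE; exact: Lx.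
apply/esym/maxL => //; rewrite inE; apply/andP; split.
  by apply: contraNneq L0 => A0; rewrite -finset.subset0 -A0.
by apply/asboolP; exists x => k; rewrite inE.
Qed.

Lemma acceptable_closed (R : realType) (K : finType) (X : topologicalType)
    (U : K -> X -> R) (u0 : K -> R) (L : {set K}) :
  (forall k, continuous (U k)) -> closed (acceptable U u0 L).
Proof.
move=> cU.
have -> : acceptable U u0 L =
    \bigcap_(k in [set k | k \in L]) (U k @^-1` [set y | u0 k <= y]).
  by [].
apply: closed_bigI => k _.
by apply: preimage_closed (@closed_ge _ _) => x _; exact: cU.
Qed.

Lemma argmax_expected_utility (R : realType) (K : finType)
    (X : topologicalType) (U V : K -> X -> R) (u0 q : K -> R) (L : {set K}) :
  compact [set: X] -> (forall k, continuous (U k)) ->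
  (forall k, continuous (V k)) -> acceptable U u0 L !=set0 ->
  argmax (acceptable U u0 L) (fun x => \sum_(k : K) q k * V k x) !=set0.
Proof.
move=> cX cU cV L0.
have cL : compact (acceptable U u0 L).
  exact: subclosed_compact (acceptable_closed cU) cX (@subsetT _ _).
have cE : continuous (fun x => \sum_(k : K) q k * V k x).
  move=> x; apply: cvg_big => [|k _]; first exact: add_continuous.
  by apply: cvgM; [exact: cvg_cst|exact: cV].
have [x Lx maxx] := compact_EVT_max L0 cL (continuous_subspaceT cE).
by exists x; split=> [|y Ly]; [rewrite inE in Lx|apply: maxx; rewrite inE].
Qed.

(** Each class of [f] is labelled by a message through a representative of it
    that depends on the class alone. *)
Lemma labelling_of_classes (K M : finType) (T : eqType) (f : K -> T) :
  (#|K| <= #|M|)%N ->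
  exists label : K -> M, forall j k, (label j == label k) = (f j == f k).
Proof.
move=> leKM.
pose rep k := choose (fun j => f j == f k) k.
have f_rep k : f (rep k) = f k by apply/eqP/(@chooseP _ (fun j => f j == f k)).
exists (fun k => enum_val (widen_ord leKM (enum_rank (rep k)))) => j k.
rewrite (inj_eq enum_val_inj) -val_eqE /= val_eqE (inj_eq enum_rank_inj).
apply/eqP/eqP => [eq_rep|fjk]; first by rewrite -f_rep eq_rep f_rep.
by rewrite /rep fjk; apply: choose_id; rewrite ?fjk.
Qed.

Section PureReports.
Variables (R : realType) (K M : finType) (p : K -> R) (mu : K -> M).

Definition pure_report (k : K) (m : M) : R := (m == mu k)%:R.

Lemma pure_report_distr (k : K) : is_distr (pure_report k).
Proof.
split=> [m|]; first by rewrite ler0n.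
by rewrite (bigD1 (mu k)) //= big1 /pure_report ?eqxx ?addr0 // => m /negbTE ->.
Qed.

Lemma message_prob_pure_gt0 (m : M) :
  0 < message_prob p pure_report m -> exists k, mu k = m.
Proof.
have [[k mk] _|noK] := pselect (exists k, mu k = m); first by exists k.
rewrite /message_prob big1 ?ltxx // => k _.
rewrite /pure_report; case: eqP => [mk|_]; last by rewrite mulr0.
by case: noK; exists k.
Qed.

(** Positivity of the prior makes every sender of [m] visible in the posterior;
    for a message without senders both sides are empty. *)
Lemma supp_posterior_pure (m : M) : (forall k, 0 < p k) ->
  supp (posterior p pure_report m) = [set k | mu k == m]%SET.
Proof.
move=> p0; apply/setP => k; rewrite !inE /posterior /pure_report [m == _]eq_sym.
have [mk|_] := eqVneq (mu k) m; last by rewrite mulr0 mul0r eqxx.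
rewrite mulr1 mulf_neq0 ?invr_eq0 ?gt_eqF // /message_prob (bigD1 k) //=.
rewrite /pure_report mk eqxx mulr1 ltr_pwDl // sumr_ge0 // => j _.
by rewrite mulr_ge0 // ltW.
Qed.

End PureReports.

Theorem proposition6 (R : realType) (K M : finType) (X : topologicalType)
  (p : K -> R) (U V : K -> X -> R) (u0 : K -> R)
  (K_nonempty : (0 < #|K|)%N)
  (p_distr : is_distr p)
  (p_gt0 : forall k, 0 < p k)
  (card_M : (#|K| <= #|M|)%N)
  (X_compact : compact [set: X])
  (U_continuous : forall k, continuous (U k))
  (V_continuous : forall k, continuous (V k))
  (individually_acceptable : forall k, exists x, u0 k <= U k x)
  (Tstar_partition :
     finset.partition (participation_structure U u0) (finset.setTfor K)) :
  exists (sigma : K -> M -> R) (tau : M -> X),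
    partitional_equilibrium p U V u0 sigma tau.
Proof.
set P := participation_structure U u0 in Tstar_partition *.
have [/eqP covP triv _] := and3P Tstar_partition.
pose cell := finset.pblock P.
have k_cov k : k \in finset.cover P by rewrite covP finset.in_setT.
have k_cell k : k \in cell k by rewrite finset.mem_pblock.
have cellP k : cell k \in P by rewrite finset.pblock_mem.
have [mu muE] := labelling_of_classes cell card_M.
pose post := posterior p (pure_report R mu).
have supp_post k : supp (post (mu k)) = cell k.
  rewrite supp_posterior_pure //; apply/setP => j; rewrite inE muE.
  by rewrite eq_sym finset.eq_pblock.
have cell0 k : acceptable U u0 (cell k) !=set0.
  have := cellP k; rewrite inE => /maxsetP[]; rewrite inE => /andP[_ +] _.
  by move/asboolP.
have /card_gt0P[k0 _] := K_nonempty.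
pose best m x :=
  argmax (acceptable U u0 (supp (post m))) (fun x => \sum_k post m k * V k x) x.
have /choice[answer answerP] k : exists x, best (mu k) x.
  by apply: argmax_expected_utility; rewrite ?supp_post.
(* A message that no type sends is read as if some type had sent it. *)
have /choice[sender senderP] m : exists k, (exists j, mu j = m) -> mu k = m.
  have [[k km]|unsent] := pselect (exists j, mu j = m); first by exists k.
  by exists k0.
(* Two maximizers may differ in the sender's utility, so the reply to a type has
   to depend on its message only: hence the detour through [sender]. *)
pose reply k := answer (sender (mu k)).
have mu_sender k : mu (sender (mu k)) = mu k by apply: senderP; exists k.
have best_reply k : best (mu k) (reply k) by rewrite -mu_sender; exact: answerP.
have reply_acc k : acceptable U u0 (cell k) (reply k).
  by have [] := best_reply k; rewrite supp_post.
exists (pure_report R mu), (fun m => reply (sender m)).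
split; last by move=> k; exists (mu k).
split=> [k|k m m'|m].
- exact: pure_report_distr.
- rewrite /pure_report ltr0n lt0b => /eqP -> {m}.
  rewrite {2}/reply mu_sender -/(reply k).
  set j := sender m'.
  have [jk|] := boolP (k \in cell j).
    have : mu j == mu k by rewrite muE finset.eq_pblock.
    by rewrite /reply => /eqP ->.
  rewrite (accepting_types_maximal (cellP j) (reply_acc j)) inE -ltNge.
  by move=> /ltW/le_trans; apply; apply: reply_acc.
- move=> /message_prob_pure_gt0[k <-] /=.
  rewrite /reply mu_sender -/(reply k).
  by split; [exists (reply k); have [] := best_reply k|exact: best_reply].
Qed.
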